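(* Let $\mathcal A$ and $\mathcal B$ be countable structures (each with domain $\omega$, in countable relational languages). Then every continuous group homomorphism $H\colon \mathrm{Aut}(\mathcal B)\to \mathrm{Aut}(\mathcal A)$ is of the form $H=G_{\mathcal I}$ for some infinitary interpretation $\mathcal I$ of $\mathcal A$ in $\mathcal B$.
   Context: Automorphism groups carry the topology of pointwise convergence (as subgroups of $S_\infty$, the group of permutations of $\omega$). An infinitary interpretation $\mathcal I$ of $\mathcal A=(A;P_0^{\mathcal A},P_1^{\mathcal A},\dots)$ (with $P_i^{\mathcal A}\subseteq A^{a(i)}$) in $\mathcal B$ consists of relations $\mathcal{D}om^{\mathcal B}_{\mathcal A}$, $\sim$, $R_0,R_1,\dots$, each definable without parameters in $\mathcal B$ by formulas of $\mathcal L_{\omega_1\omega}$ (a subset of $\mathcal B^{<\omega}$ is definable if each of its intersections with $\mathcal B^{n}$ is), such that $\mathcal{D}om^{\mathcal B}_{\mathcal A}\subseteq \mathcal B^{<\omega}$, $\sim$ is an equivalence relation on $\mathcal{D}om^{\mathcal B}_{\mathcal A}$, each $R_i\subseteq (\mathcal{D}om^{\mathcal B}_{\mathcal A})^{a(i)}$ is closed under $\sim$, together with a function $f^{\mathcal B}_{\mathcal A}\colon \mathcal{D}om^{\mathcal B}_{\mathcal A}\to A$ inducing an isomorphism $(\mathcal{D}om^{\mathcal B}_{\mathcal A}/\!\sim;R_0/\!\sim,R_1/\!\sim,\dots)\cong(A;P_0^{\mathcal A},P_1^{\mathcal A},\dots)$. For such $\mathcal I$, the homomorphism $G_{\mathcal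 I}\colon\mathrm{Aut}(\mathcal B)\to\mathrm{Aut}(\mathcal A)$ is $G_{\mathcal I}(f)=f^{\mathcal B}_{\mathcal A}\circ\tilde f\circ (f^{\mathcal B}_{\mathcal A})^{-1}$, where $\tilde f$ is the permutation of $\mathcal{D}om^{\mathcal B}_{\mathcal A}$ obtained by applying $f$ coordinatewise to tuples (this is well defined on $\sim$-classes). *)

(* Defs.v *)
From HB Require Import structures.
From mathcomp Require Import all_boot all_order.
From mathcomp Require Import boolp classical_sets functions.
From mathcomp Require Import topology function_spaces.

Set Implicit Arguments.
Unset Strict Implicit.
Unset Printing Implicit Defensive.

Local Open Scope classical_set_scope.

Record language := Language {
  symb : countType;
  arity : symb -> nat }.

(** Structures with domain [nat]. *)
Record structure (L : language) := Structure {
  rel_of : forall s : symb L, set ((arity s).-tuple nat) }.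

(** [formula L n]: the L_{omega_1,omega} formulas over [L] whose free variables
    are among [n] variables. [FEx] and [FAll] bind variable [0] and shift the
    others. Connectives are indexed by [nat]: finite ones are obtained by
    repetition, and the empty ones as [FAll (FEq ord0 ord0)] and its negation. *)
Inductive formula (L : language) : nat -> Type :=
| FRel n (s : symb L) (t : (arity s).-tuple 'I_n) : formula L n
| FEq n (i j : 'I_n) : formula L n
| FNot n (p : formula L n) : formula L n
| FAnd n (p : nat -> formula L n) : formula L n
| FOr n (p : nat -> formula L n) : formula L n
| FEx n (p : formula L n.+1) : formula L n
| FAll n (p : formula L n.+1) : formula L n.

Definition vcons n (a : nat) (v : 'I_n -> nat) : 'I_n.+1 -> nat :=
  fun i => oapp v a (unlift ord0 i).

Fixpoint sat L (B : structure L) n (p : formula L n) : ('I_n -> nat) -> Prop :=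
  match p in formula _ n return ('I_n -> nat) -> Prop with
  | FRel _ s t => fun v => rel_of B (map_tuple v t)
  | FEq _ i j => fun v => v i = v j
  | FNot _ p => fun v => ~ sat B p v
  | FAnd _ p => fun v => forall k, sat B (p k) v
  | FOr _ p => fun v => exists k, sat B (p k) v
  | FEx _ p => fun v => exists a, sat B p (vcons a v)
  | FAll _ p => fun v => forall a, sat B p (vcons a v)
  end.

(** Parameter-free definability of a [k]-ary relation on finite tuples: for all
    lengths [l_1, ..., l_k], the part of [R] in B^l_1 * ... * B^l_k, seen as a
    subset of B^(l_1 + ... + l_k), is defined by some formula. *)
Definition definable L (B : structure L) k (R : set (k.-tuple (seq nat))) :=
  forall ls : k.-tuple nat, exists p : formula L (sumn ls),
    forall xs : k.-tuple (seq nat), map size xs = ls ->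
      (R xs <-> sat B p (fun i => nth 0 (flatten xs) i)).

Record aut L (B : structure L) := Aut {
  aut_fun :> nat -> nat;
  aut_bij : bijective aut_fun;
  aut_rel : forall (s : symb L) (xs : (arity s).-tuple nat),
    rel_of B (map_tuple aut_fun xs) <-> rel_of B xs }.

Section AutGroup.
Variables (L : language) (B : structure L).
Implicit Types g h : aut B.

Lemma aut_eq g h : g =1 h -> g = h.
Proof.
case: g h => g gb gr [h hb hr] /= /funext e.
by case: _ / e in hb hr *; congr Aut; exact: Prop_irrelevance.
Qed.

Lemma aut_surj g y : exists x, g x = y.
Proof. by case: (aut_bij g) => g' _ gK; exists (g' y). Qed.

Definition aut_inv_fun g y := projT1 (cid (aut_surj g y)).

Lemma aut_inv_funK g : cancel (aut_inv_fun g) g.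
Proof. by move=> y; exact: projT2 (cid (aut_surj g y)). Qed.

Lemma aut_funK g : cancel g (aut_inv_fun g).
Proof. by move=> x; apply: (bij_inj (aut_bij g)); rewrite aut_inv_funK. Qed.

Definition aut_one : aut B.
Proof.
exists id; first by exists id.
move=> s xs.
by have -> : map_tuple id xs = xs; first by apply: val_inj; rewrite /= map_id.
Defined.

Definition aut_mul g h : aut B.
Proof.
exists (g \o h); first exact: bij_comp (aut_bij g) (aut_bij h).
move=> s xs; rewrite -(aut_rel h xs) -(aut_rel g (map_tuple h xs)).
have -> : map_tuple (g \o h) xs = map_tuple g (map_tuple h xs).
  by apply: val_inj; rewrite /= map_comp.
by [].
Defined.

Definition aut_inv g : aut B.
Proof.
exists (aut_inv_fun g).
  by exists g; [exact: aut_inv_funK | exact: aut_funK].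
move=> s xs; rewrite -(aut_rel g).
have -> : map_tuple g (map_tuple (aut_inv_fun g) xs) = xs; last by [].
by apply: val_inj; rewrite /= (mapK (aut_inv_funK g)).
Defined.

HB.instance Definition _ := gen_eqMixin (aut B).
HB.instance Definition _ := gen_choiceMixin (aut B).

Fact aut_mulA : associative aut_mul. Proof. by move=> g h k; exact: aut_eq. Qed.
Fact aut_mul1g : left_id aut_one aut_mul. Proof. by move=> g; exact: aut_eq. Qed.
Fact aut_mulg1 : right_id aut_one aut_mul. Proof. by move=> g; exact: aut_eq. Qed.
Fact aut_mulVg : left_inverse aut_one aut_inv aut_mul.
Proof. by move=> g; apply: aut_eq => x /=; rewrite aut_funK. Qed.
Fact aut_mulgV : right_inverse aut_one aut_inv aut_mul.
Proof. by move=> g; apply: aut_eq => x /=; rewrite aut_inv_funK. Qed.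

HB.instance Definition _ := isGroup.Build (aut B)
  aut_mulA aut_mul1g aut_mulg1 aut_mulVg aut_mulgV.

(** Pointwise convergence, [nat] being discrete. *)
HB.instance Definition _ := Topological.copy (aut B)
  (initial_topology (@aut_fun L B : aut B -> {ptws nat -> nat})).

End AutGroup.

(** The values of [int_map] outside [int_dom] are irrelevant. The last four
    fields say that it induces an isomorphism from the quotient by [int_sim]. *)
Record interpretation LA LB (A : structure LA) (B : structure LB) :=
  Interpretation {
  int_dom : set (seq nat);
  int_sim : seq nat -> seq nat -> Prop;
  int_rel : forall s : symb LA, set ((arity s).-tuple (seq nat));
  int_map : seq nat -> nat;
  int_dom_def : definable B [set xs : 1.-tuple _ | int_dom (thead xs)];
  int_sim_def : definable B
    [set xs : 2.-tuple _ | int_sim (tnth xs ord0) (tnth xs ord_max)];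
  int_rel_def : forall s, definable B (@int_rel s);
  int_sim_dom : forall x y, int_sim x y -> int_dom x /\ int_dom y;
  int_sim_refl : forall x, int_dom x -> int_sim x x;
  int_sim_sym : forall x y, int_sim x y -> int_sim y x;
  int_sim_trans : forall x y z, int_sim x y -> int_sim y z -> int_sim x z;
  int_rel_dom : forall s (xs : (arity s).-tuple (seq nat)),
    int_rel xs -> forall i, int_dom (tnth xs i);
  int_rel_sim : forall s (xs ys : (arity s).-tuple (seq nat)),
    (forall i, int_sim (tnth xs i) (tnth ys i)) -> int_rel xs -> int_rel ys;
  int_map_sim : forall x y, int_sim x y -> int_map x = int_map y;
  int_map_inj : forall x y, int_dom x -> int_dom y ->
    int_map x = int_map y -> int_sim x y;
  int_map_surj : forall a, exists2 x, int_dom x & int_map x = a;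
  int_map_rel : forall s (xs : (arity s).-tuple (seq nat)),
    (forall i, int_dom (tnth xs i)) ->
    (int_rel xs <-> rel_of A (map_tuple int_map xs)) }.

Section Invariance.
Variables (L : language) (B : structure L) (g : aut B).

Lemma sat_aut n (p : formula L n) v : sat B p (g \o v) <-> sat B p v.
Proof.
have gvcons m a (w : 'I_m -> nat) : vcons (g a) (g \o w) = g \o vcons a w.
  by apply/funext => i; rewrite /vcons /=; case: unliftP.
elim: p v => [m s t|m i j|m p IH|m p IH|m p IH|m p IH|m p IH] v /=.
- rewrite -(aut_rel g (map_tuple v t)).
  rewrite (_ : map_tuple (g \o v) t = map_tuple g (map_tuple v t))//.
  by apply: val_inj; rewrite /= map_comp.
- by split => [/(bij_inj (aut_bij g))|->].
- by rewrite IH.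
- by split=> H k; apply/IH.
- by split=> -[k H]; exists k; apply/IH.
- split=> -[a H].
    have [b ab] := aut_surj g a; exists b; apply/IH.
    by rewrite -gvcons ab.
  by exists (g a); rewrite gvcons; apply/IH.
- split=> H a; first by apply/IH; rewrite -gvcons; exact: H.
  by have [b <-] := aut_surj g a; rewrite gvcons; apply/IH.
Qed.

Lemma definable_aut k (R : set (k.-tuple (seq nat))) xs : definable B R ->
  R (map_tuple (map g) xs) <-> R xs.
Proof.
move=> /(_ (map_tuple size xs))[p pP]; rewrite (pP xs)// pP; last first.
  by rewrite /= -map_comp; apply: eq_map => x /=; rewrite size_map.
apply: iff_trans (sat_aut p _); rewrite (_ : (fun i : 'I__ => _) =
  g \o (fun i : 'I_(sumn (map_tuple size xs)) => nth 0 (flatten xs) i))//.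
apply: funext => i /=; rewrite -map_flatten (nth_map 0)// size_flatten.
exact: ltn_ord.
Qed.

End Invariance.

Section InterpretationHom.
Variables (LA LB : language) (A : structure LA) (B : structure LB).
Variable I : interpretation A B.
Implicit Types g h : aut B.

Lemma int_dom_aut g x : int_dom I (map g x) <-> int_dom I x.
Proof.
have := definable_aut g [tuple x] (int_dom_def I).
by rewrite /= /thead !(tnth_nth [::]).
Qed.

Lemma int_sim_aut g x y : int_sim I (map g x) (map g y) <-> int_sim I x y.
Proof.
have := definable_aut g [tuple x; y] (int_sim_def I).
by rewrite /= !(tnth_nth [::]).
Qed.

(** A representative of the class f^-1(a). *)
Definition int_rep a : seq nat := s2val (cid2 (int_map_surj I a)).

Lemma int_rep_dom a : int_dom I (int_rep a).
Proof. exact: s2valP (cid2 (int_map_surj I a)). Qed.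

Lemma int_repK : cancel int_rep (int_map I).
Proof. by move=> a; exact: s2valP' (cid2 (int_map_surj I a)). Qed.

Definition interp_hom_fun g a : nat := int_map I (map g (int_rep a)).

Lemma interp_hom_funE g x : int_dom I x ->
  interp_hom_fun g (int_map I x) = int_map I (map g x).
Proof.
move=> xD; apply: int_map_sim; apply/int_sim_aut.
by apply: int_map_inj => //; [exact: int_rep_dom | rewrite int_repK].
Qed.

Lemma interp_hom_funK g h : cancel g h ->
  cancel (interp_hom_fun g) (interp_hom_fun h).
Proof.
move=> gK a; rewrite interp_hom_funE; last exact/int_dom_aut/int_rep_dom.
by rewrite (mapK gK) int_repK.
Qed.

Definition interp_hom g : aut A.
Proof.
exists (interp_hom_fun g).
  exists (interp_hom_fun g^-1%g); apply: interp_hom_funK.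
    exact: aut_funK.
  exact: aut_inv_funK.
move=> s xs; pose ys := map_tuple int_rep xs.
have ysD i : int_dom I (tnth ys i) by rewrite tnth_map; exact: int_rep_dom.
have -> : map_tuple (interp_hom_fun g) xs =
    map_tuple (int_map I) (map_tuple (map g) ys).
  by apply: val_inj; rewrite /= -!map_comp.
have -> : rel_of A xs = rel_of A (map_tuple (int_map I) ys).
  congr rel_of.
  by apply: val_inj; rewrite /= (mapK int_repK).
rewrite -(int_map_rel ysD) -int_map_rel.
  exact: (definable_aut g ys (@int_rel_def _ _ _ _ I s)).
by move=> i; rewrite tnth_map; exact/int_dom_aut.
Defined.

Lemma interp_homE g x : int_dom I x ->
  interp_hom g (int_map I x) = int_map I (map g x).
Proof. exact: interp_hom_funE. Qed.

Lemma interp_homM : {morph interp_hom : g h / (g * h)%g}.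
Proof.
move=> g h; apply: aut_eq => a.
have D := int_rep_dom a; rewrite -[a]int_repK.
have -> : (interp_hom g * interp_hom h)%g (int_map I (int_rep a)) =
  interp_hom g (interp_hom h (int_map I (int_rep a))) by [].
rewrite (interp_homE _ D) (interp_homE h D) interp_homE; last first.
  exact/int_dom_aut.
by rewrite -map_comp.
Qed.

HB.instance Definition _ :=
  isMultiplicative.Build (aut B) (aut A) interp_hom interp_homM.

End InterpretationHom.

(* Main.v *)
(** Two tuples of [B] that satisfy the same formulas are conjugate under Aut(B):
    if no [b] extended the equivalence of [v] and [w] to [(a, v)] and [(b, w)],
    the countably many formulas separating [(a, v)] from the [(b, w)] would have
    a conjunction [p] with [exists x, p] true at [v] and false at [w]; so
    elementary equivalence is a back-and-forth system. Hence an invariant set of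
    tuples is definable, as a countable union of countable intersections.
    By continuity, [H g a] depends only on [g 0, ..., g (m - 1)] for some
    [m = m(a)], and [m] can be made injective. The tuples
    [(g 0, ..., g (m(a) - 1))] then form an invariant domain on which
    [(g 0, ..., g (m(a) - 1)) |-> H g a] is well defined, equivariant and onto:
    the length of a tuple determines [a]. *)

Require Import Defs.
From HB Require Import structures.
From mathcomp Require Import all_boot all_order.
From mathcomp Require Import boolp classical_sets functions.
From mathcomp Require Import topology function_spaces.

Set Implicit Arguments.
Unset Strict Implicit.
Unset Printing Implicit Defensive.

Local Open Scope classical_set_scope.

(** * Back-and-forth, and definability of invariant relations *)

Section ElementaryEquivalence.
Variables (L : language) (B : structure L).

Definition elem_equiv n (v w : 'I_n -> nat) :=
  forall p : formula L n, sat B p v <-> sat B p w.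

Lemma elem_equiv_sym n (v w : 'I_n -> nat) : elem_equiv v w -> elem_equiv w v.
Proof. by move=> vw p; rewrite (vw p). Qed.

Lemma not_elem_equiv n (v w : 'I_n -> nat) : ~ elem_equiv v w ->
  exists p : formula L n, sat B p v /\ ~ sat B p w.
Proof.
move=> /existsNP[p].
have [pv|npv] := pselect (sat B p v) => npvw.
  by exists p; split=> // pw; apply: npvw.
exists (FNot p); split=> //= npw; apply: npvw; split=> //.
Qed.

Lemma elem_equiv_forth n (v w : 'I_n -> nat) a : elem_equiv v w ->
  exists b, elem_equiv (vcons a v) (vcons b w).
Proof.
move=> vw; apply: contrapT => /forallNP nvw.
have /choice[p pP] b := not_elem_equiv (nvw b).
(* The conjunction is indexed by [nat], the domain of [B], so the witness [b] found on the side of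
   [w] must satisfy its own separator [p b]. *)
have /vw[b /(_ b)] : sat B (FEx (FAnd p)) v by exists a => b; case: (pP b).
by case: (pP b).
Qed.

(** A finite partial map, stored as an enumeration of its graph; repeated pairs are allowed, so that
    extending it is just [vcons]. *)
Record partial_elem := PartialElem {
  pe_size : nat;
  pe_dom : 'I_pe_size -> nat;
  pe_cod : 'I_pe_size -> nat;
  pe_equiv : elem_equiv pe_dom pe_cod }.

Arguments pe_dom : clear implicits.
Arguments pe_cod : clear implicits.
Arguments pe_equiv : clear implicits.

Implicit Types q r : partial_elem.

Definition relates q a b := exists2 i, pe_dom q i = a & pe_cod q i = b.

Definition pe_inv q := PartialElem (elem_equiv_sym (pe_equiv q)).

Lemma relates_inv q a b : relates (pe_inv q) a b <-> relates q b a.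
Proof. by split=> -[i]; exists i. Qed.

(** Equality is itself a formula, hence preserved; applied to [pe_inv q], this also gives
    injectivity. *)
Lemma relates_fun q a b c : relates q a b -> relates q a c -> b = c.
Proof.
by move=> [i ia <-] [j ja <-]; apply/(pe_equiv q (FEq _ i j)); rewrite /= ia.
Qed.

Lemma relates_rel q (s : symb L) (xs ys : (arity s).-tuple nat) :
  (forall i, relates q (tnth xs i) (tnth ys i)) ->
  rel_of B xs <-> rel_of B ys.
Proof.
move=> xsys.
have /choice[c cP] i : exists j,
    pe_dom q j = tnth xs i /\ pe_cod q j = tnth ys i.
  by have [j] := xsys i; exists j.
have -> : xs = map_tuple (pe_dom q) (mktuple c).
  by apply: eq_from_tnth => i; rewrite tnth_map tnth_mktuple (cP i).1.
have -> : ys = map_tuple (pe_cod q) (mktuple c).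
  by apply: eq_from_tnth => i; rewrite tnth_map tnth_mktuple (cP i).2.
exact: (pe_equiv q (FRel (mktuple c))).
Qed.

Lemma relates_forth q a : exists r,
  (forall x y, relates q x y -> relates r x y) /\ exists b, relates r a b.
Proof.
have [b ab] := elem_equiv_forth a (pe_equiv q).
exists (PartialElem ab); split; last first.
  by exists b, ord0; rewrite /= /vcons unlift_none.
by move=> x y [i ix iy]; exists (lift ord0 i); rewrite /= /vcons liftK.
Qed.

Lemma relates_back_forth q k : exists r,
  [/\ forall x y, relates q x y -> relates r x y,
      exists b, relates r k b & exists a, relates r a k].
Proof.
have [r [qr [b kb]]] := relates_forth q k.
(* The back step is the forth step of the inverse map. *)
have [t [rt [a ka]]] := relates_forth (pe_inv r) k.
have {}rt x y : relates r x y -> relates (pe_inv t) x y.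
  by move=> /relates_inv/rt; rewrite relates_inv.
exists (pe_inv t); split.
- by move=> x y /qr/rt.
- by exists b; exact: rt.
- by exists a; apply/relates_inv.
Qed.

Lemma elem_equiv_aut n (v w : 'I_n -> nat) : elem_equiv v w ->
  exists g : aut B, g \o v = w.
Proof.
move=> vw.
have /choice[ext extP] (qk : partial_elem * nat) :=
  relates_back_forth qk.1 qk.2.
(* Stage [0] is the given pair [v], [w]; passing from stage [l] to [l.+1] puts [l] into both domain
   and range, so the union is a permutation. *)
pose chain := fix chain k :=
  if k is l.+1 then ext (chain l, l) else PartialElem vw.
have chain_le k l x y : (k <= l)%N ->
    relates (chain k) x y -> relates (chain l) x y.
  move=> /subnK <-; elim: (l - k)%N => // m IH /IH.
  by rewrite addSn; case: (extP (chain (m + k)%N, (m + k)%N)) => + _ _; apply.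
pose G x y := exists k, relates (chain k) x y.
have G_fun x y z : G x y -> G x z -> y = z.
  move=> [k xy] [l xz]; apply: (@relates_fun (chain (maxn k l)) x).
    exact: chain_le (leq_maxl k l) xy.
  exact: chain_le (leq_maxr k l) xz.
have G_inj x y z : G x z -> G y z -> x = y.
  move=> [k xz] [l yz].
  apply: (@relates_fun (pe_inv (chain (maxn k l))) z); apply/relates_inv.
    exact: chain_le (leq_maxl k l) xz.
  exact: chain_le (leq_maxr k l) yz.
have /choice[g gP] x : exists y, G x y.
  by case: (extP (chain x, x)) => _ [y xy] _; exists y, x.+1.
have /choice[h hP] y : exists x, G x y.
  by case: (extP (chain y, y)) => _ _ [x xy]; exists x, y.+1.
have g_bij : bijective g.
  exists h => x; first exact: G_inj (hP _) (gP _).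
  exact: G_fun (gP _) (hP _).
have g_rel (s : symb L) (xs : (arity s).-tuple nat) :
    rel_of B (map_tuple g xs) <-> rel_of B xs.
  (* An atomic relation has finitely many arguments, so a single stage [m] relates all of them to
     their images. *)
  have /choice[l lP] := gP.
  pose m := \max_(i < arity s) l (tnth xs i).
  apply: iff_sym; apply: (@relates_rel (chain m)) => i.
  rewrite tnth_map; apply: chain_le (lP _).
  exact: (leq_bigmax (F := fun i => l (tnth xs i))).
exists (Aut g_bij g_rel); apply/funext => i /=.
by apply: G_fun (gP _) _; exists 0%N, i.
Qed.

Lemma invariant_sat n (S : set ('I_n -> nat)) :
  (forall (g : aut B) v, S v -> S (g \o v)) ->
  exists p : formula L n, forall v, S v <-> sat B p v.
Proof.
move=> Sinv.
pose FT : formula L n := FAll (FEq L ord0 ord0).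
have FT_sat v : sat B FT v by [].
(* An enumeration of all [n]-tuples; numbers that code no tuple give the zero tuple. *)
pose e k : 'I_n -> nat :=
  odflt [ffun=> 0%N] (unpickle k : option {ffun 'I_n -> nat}).
have e_surj v : exists k, e k = v.
  exists (pickle [ffun i => v i]); rewrite /e pickleK.
  by apply/funext => i /=; rewrite ffunE.
have sep v w : exists p : formula L n, S v -> sat B p v /\ (sat B p w -> S w).
  have [Sw|nSw] := pselect (S w); first by exists FT.
  have [Sv|nSv] := pselect (S v); last by exists FT.
  have [|p [pv npw]] := @not_elem_equiv _ v w; last by exists p.
  by move=> /elem_equiv_aut[g vw]; apply: nSw; rewrite -vw; exact: Sinv.
(* A tuple [e k] in [S] contributes the conjunction of its separators from every [e l]; one outside
   [S] contributes a false disjunct. *)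
have /choice[p pP] k : exists p : formula L n,
    (S (e k) -> sat B p (e k)) /\ (forall w, sat B p w -> S w).
  have [Sk|nSk] := pselect (S (e k)); last by exists (FNot FT); split=> // w [].
  have /choice[q qP] l := sep (e k) (e l).
  exists (FAnd q); split=> [_ l|w]; first by case: (qP l Sk).
  by have [l <-] := e_surj w; move=> /(_ l); case: (qP l Sk).
exists (FOr p) => v; split=> [|[k]]; last by case: (pP k) => _; apply.
by have [k <-] := e_surj v; exists k; apply: (pP k).1.
Qed.

Lemma invariant_definable k (R : set (k.-tuple (seq nat))) :
  (forall (g : aut B) xs, R xs -> R (map_tuple (map g) xs)) -> definable B R.
Proof.
move=> Rinv ls.
pose flat (xs : k.-tuple (seq nat)) : 'I_(sumn ls) -> nat :=
  fun i => nth 0%N (flatten xs) i.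
pose S := [set v | exists xs : k.-tuple (seq nat),
  [/\ map size xs = ls, R xs & flat xs = v]].
have [|p pP] := @invariant_sat _ S.
  move=> g _ [xs [xsls Rxs <-]]; exists (map_tuple (map g) xs).
  split; first 1 last.
  - exact: Rinv.
  - apply/funext => i; rewrite /flat /= -map_flatten (nth_map 0%N)//.
    by rewrite size_flatten /shape xsls.
  - by rewrite -xsls /= -map_comp; apply: eq_map => x /=; rewrite size_map.
exists p => xs xsls; rewrite -[sat _ _ _](pP _).
split=> [Rxs|]; first by exists xs.
move=> [ys [ysls Rys ysxs]].
(* With the lengths fixed by [ls], the concatenation determines the tuples. *)
suff -> : xs = ys by [].
apply/val_inj/eq_from_flatten_shape; last by rewrite /shape xsls ysls.
apply: (@eq_from_nth _ 0%N); first by rewrite !size_flatten /shape xsls ysls.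
rewrite size_flatten /shape xsls => i ilt.
by have /(congr1 (@^~ (Ordinal ilt))) := ysxs.
Qed.

End ElementaryEquivalence.

(** * Neighbourhoods of the identity under pointwise convergence *)

Section Topology.
Variables (L : language) (B : structure L).

Lemma nbhs_aut_stab (a : nat) : nbhs (1%g : aut B) [set g : aut B | g a = a].
Proof.
have aut_cont : continuous (@aut_fun L B : aut B -> {ptws nat -> nat}).
  exact: initial_continuous.
apply: (aut_cont 1%g [set f | f a = a]).
exact: (@proj_continuous nat (fun=> nat) a id [set a] (discrete_set1 a)).
Qed.

Lemma nbhs1_aut (U : set (aut B)) : nbhs (1%g : aut B) U ->
  exists m : nat, forall g : aut B, (forall i, (i < m)%N -> g i = i) -> U g.
Proof.
(* The filter generated by the basic neighbourhoods of [id]; its convergence to [id] puts one of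
   them inside each neighbourhood. *)
pose F : set_system {ptws nat -> nat} :=
  [set V | exists m, forall f, (forall i, (i < m)%N -> f i = i) -> V f].
have FF : Filter F.
  split=> [|V W [m mV] [l lW]|V W VW [m mV]]; first by exists 0%N.
    exists (maxn m l) => f fE; split.
      by apply: mV => i im; apply: fE; rewrite leq_max im.
    by apply: lW => i il; apply: fE; rewrite leq_max il orbT.
  by exists m => f /mV/VW.
have Fid : F --> (id : {ptws nat -> nat}).
  apply/pointwise_cvgP => a V /nbhs_singleton Va.
  by exists a.+1 => f /(_ a (ltnSn a)) /= ->.
rewrite nbhsE => -[_ [[V Vop <-] V1] VU].
have [m mV] : F V by apply: Fid; apply: open_nbhs_nbhs.
by exists m => g gm; apply: VU; exact: mV.
Qed.

End Topology.

(** * From a continuous homomorphism to an interpretation *)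

Section InterpretationOfHom.
Variables (LA LB : language) (A : structure LA) (B : structure LB).
Variable H : {multiplicative aut B -> aut A}.
Hypothesis Hcont : continuous H.

Lemma hom1 : H 1%g = 1%g.
Proof. by apply: (mulgI (H 1%g)); rewrite -gmulfM !mulg1. Qed.

Lemma hom_stab (a : nat) : exists m : nat,
  forall g : aut B, (forall i, (i < m)%N -> g i = i) -> H g a = a.
Proof.
apply: (@nbhs1_aut _ _ [set g | H g a = a]).
have H1 : nbhs (H 1%g) [set h | h a = a] by rewrite hom1; exact: nbhs_aut_stab.
exact: Hcont H1.
Qed.

Lemma hom_supports : exists m : nat -> nat, injective m /\
  forall a (g h : aut B),
    map g (iota 0 (m a)) = map h (iota 0 (m a)) -> H g a = H h a.
Proof.
have /choice[m mP] := hom_stab.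
(* The summands [(m i).+1] make [n] strictly increasing, hence injective, while keeping [n a] above
   [m a]. *)
pose n a := (\sum_(i < a.+1) (m i).+1)%N.
have n_mono : {homo n : a b / (a < b)%N}.
  apply: homo_ltn => [? ? ?|a]; first exact: ltn_trans.
  by rewrite /n [X in (_ < X)%N]big_ord_recr /= addnS ltnS leq_addr.
exists n; split=> [|a g h /eq_in_map gh]; first exact/incn_inj/leq_mono.
(* As [h^-1 * g] fixes every point below [m a], its image under [H] fixes [a]. *)
have -> : g = (h * (h^-1 * g))%g by rewrite mulgA mulgV mul1g.
rewrite gmulfM -[LHS]/(H h (H (h^-1 * g)%g a)) (mP a (h^-1 * g)%g) // => i im.
have gi : g i = h i.
  apply: gh; rewrite mem_iota /= add0n (leq_trans im)//.
  by rewrite /n big_ord_recr /= (leq_trans (leqnSn _)) ?leq_addl.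
by rewrite -[LHS]/(aut_inv_fun h (g i)) gi aut_funK.
Qed.

End InterpretationOfHom.

Theorem theorem1p3 (LA LB : language) (A : structure LA) (B : structure LB)
    (H : {multiplicative aut B -> aut A}) (Hcont : continuous H) :
  exists I : interpretation A B, forall g : aut B, H g = interp_hom I g.
Proof.
have [m [m_inj supp]] := hom_supports Hcont.
pose code (g : aut B) a := map g (iota 0 (m a)).
pose dom := [set x | exists g a, x = code g a].
have codeM (g h : aut B) a : map g (code h a) = code (g * h)%g a.
  by rewrite -map_comp.
(* The length of a code determines [a], and then its entries determine [H g a]; off [dom] the value
   [0] is arbitrary. *)
have /choice[f fP] x : exists b, forall g a, x = code g a -> b = H g a.
  have [[h [c ->]]|ndom] := pselect (dom x); last first.
    by exists 0%N => g a xga; case: ndom; exists g, a.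
  exists (H h c) => g a hcga.
  have ca : c = a.
    by apply: m_inj; have := congr1 size hcga; rewrite !size_map !size_iota.
  by rewrite -ca in hcga *; exact: supp.
have f_code g a : f (code g a) = H g a by exact: fP.
have f_aut (g : aut B) x : dom x -> f (map g x) = H g (f x).
  by move=> [h [a ->]]; rewrite codeM !f_code gmulfM.
have dom_aut (g : aut B) x : dom x -> dom (map g x).
  by move=> [h [a ->]]; rewrite codeM; exists (g * h)%g, a.
(* Equivalence is the kernel of [f] and the relations are pulled back along [f], so an isomorphism
   is induced once [f] is onto. *)
pose sim x y := [/\ dom x, dom y & f x = f y].
pose rel (s : symb LA) := [set xs : (arity s).-tuple (seq nat) |
  (forall i, dom (tnth xs i)) /\ rel_of A (map_tuple f xs)].
have dom_def : definable B [set xs : 1.-tuple _ | dom (thead xs)].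
  apply: invariant_definable => g xs /=.
  by rewrite /thead tnth_map; exact: dom_aut.
have sim_def : definable B
    [set xs : 2.-tuple _ | sim (tnth xs ord0) (tnth xs ord_max)].
  apply: invariant_definable => g xs /= [xD yD xy].
  by rewrite !tnth_map; split; rewrite ?f_aut ?xy //; exact: dom_aut.
have rel_def s : definable B (rel s).
  apply: invariant_definable => g xs /= [xsD fxs].
  split=> [i|]; first by rewrite tnth_map; exact: dom_aut.
  move: fxs; rewrite -(aut_rel (H g)); congr rel_of.
  by apply: eq_from_tnth => i; rewrite !tnth_map f_aut.
(* The initial segment itself represents [a], whence surjectivity. *)
have f_code1 a : f (code 1%g a) = a by rewrite f_code hom1.
have code_dom g a : dom (code g a) by exists g, a.
unshelve eexists (@Interpretation _ _ A B dom sim rel f dom_def sim_def rel_def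
  _ _ _ _ _ _ _ _ _ _).
- by move=> x y [].
- by [].
- by move=> x y [].
- by move=> x y z [xD _ xy] [_ zD yz]; split; rewrite ?xy.
- by move=> s xs [].
- move=> s xs ys xys [xsD]; rewrite /rel /=.
  have -> : map_tuple f xs = map_tuple f ys.
    by apply: eq_from_tnth => i; rewrite !tnth_map; case: (xys i).
  by split=> // i; case: (xys i).
- by move=> x y [].
- by [].
- by move=> a; exists (code 1%g a).
- by move=> s xs xsD; split=> [[]|].
move=> g; apply: aut_eq => a.
(* Evaluating at the representative [code 1%g a] reduces the claim to the equivariance of [f]. *)
by rewrite -{2}(f_code1 a) interp_homE //= f_aut ?f_code1.
Qed.
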